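(* Let $\{\mathcal A\}$ be a local conformal net on the line satisfying Haag duality on $\mathbb R$. Let $W\subset\mathbb R$ be a non-empty open half-line (left or right oriented) and $W'=\mathbb R\smallsetminus\overline W$. Then $$\mathcal A(W)^\perp=\mathrm{DHR}^{W'}\{\mathcal A\},$$ where $\mathrm{DHR}^{W'}\{\mathcal A\}$ is the full subcategory of $\mathrm{DHR}\{\mathcal A\}$ whose objects are the endomorphisms localizable in $W'$.
   Context: Let $\mathcal I$ be the set of non-empty open bounded intervals of $\mathbb R$. A local conformal net on the line $\{\mathcal A\}$ consists of a complex separable Hilbert space $\mathcal H$, von Neumann algebras $\mathcal A(I)\subset\mathcal B(\mathcal H)$ for $I\in\mathcal I$, a strongly continuous unitary representation $U$ of the Möbius group $PSL(2,\mathbb R)$ (acting on $\mathbb R\cup\{\infty\}\cong S^1$) and a vector $\Omega\in\mathcal H$ such that: (isotony) $I\subset J$ implies $\mathcal A(I)\subset\mathcal A(J)$; (locality) $I\cap J=\emptyset$ implies that $\mathcal A(I)$ and $\mathcal A(J)$ commute elementwise; (covariance) $U(g)\mathcal A(I)U(g)^*=\mathcal A(gI)$ whenever $I\in\mathcal I$ and $gI\in\mathcal I$; the generator of the rotation subgroup is positive; $\Omega$ is Möbius invariant, unique up to scalars as such, and cyclic for $\{\mathcal A(I),U(g)\}$. For $S\subset\mathbb R$, $\mathcal A(S)$ denotes the von Neumann algebra (if $S$ is bounded), respectively the norm-closed $C^*$-algebra (if $S$ is unbounded), generated by all $\mathcal A(I)$ with $I\in\mathcal I$, $I\subset S$; $\mathcal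 A:=\mathcal A(\mathbb R)$ is the quasilocal $C^*$-algebra. For a region $S$ put $S'=\mathbb R\smallsetminus\overline S$. Haag duality on $\mathbb R$: $\mathcal A(I')'=\mathcal A(I)$ for all $I\in\mathcal I$. A unital $*$-endomorphism $\rho$ of $\mathcal A$ is localizable in a region $S$ (interval or half-line) if it acts trivially on every $\mathcal A(J)$, $J\in\mathcal I$, $J\subset S'$. DHR endomorphisms are the (Möbius covariant, finitely reducible) endomorphisms $\rho$ of $\mathcal A$ which are localizable in some $I\in\mathcal I$ and transportable (for every $J\in\mathcal I$ there is a unitary $u\in\mathcal A$ such that $\mathrm{Ad}_u\rho$ is localizable in $J$). They are the objects of the $C^*$ tensor category $\mathrm{DHR}\{\mathcal A\}$, with tensor product given by composition and $\mathrm{Hom}(\rho,\sigma)=\{t\in\mathcal A: t\rho(a)=\sigma(a)t\ \forall a\in\mathcal A\}$. For a unital $C^*$-subalgebra $\mathcal N\subset\mathcal A$, its dual $\mathcal N^\perp$ is the full subcategory of $\mathrm{DHR}\{\mathcal A\}$ with objects $\{\rho:\rho(n)=n\ \forall n\in\mathcal N\}$. *)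

(* Defs.v *)
From HB Require Import structures.
From mathcomp Require Import all_boot all_order all_algebra.
From mathcomp Require Import all_classical all_reals all_analysis.
From mathcomp.real_closed Require Import complex.

Set Implicit Arguments.
Unset Strict Implicit.
Unset Printing Implicit Defensive.

Import Order.TTheory GRing.Theory Num.Theory.
Import numFieldNormedType.Exports.

Local Open Scope classical_set_scope.
Local Open Scope ring_scope.

(* [inner] is linear in its first argument and conjugate linear in its second
   one.  In [R[i]], [0 <= z] means that z is real and nonnegative. *)
Record hilbertSpace (R : realType) := HilbertSpace {
  hilbert_sort :> completeNormedModType R[i] ;
  inner : {dot hilbert_sort for Num.conj} ;
  inner_norm : forall x, `|x| ^+ 2 = inner x x }.

Section Operators.
Context {R : realType} {H : hilbertSpace R}.
Local Notation op := (H -> H).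
Implicit Types (T S u : op) (M X : set op).

Definition bounded_op : set op := [set T | linear T /\ continuous T].

Definition is_adjoint T S := forall x y, inner H (T x) y = inner H x (S y).

(* By the Riesz representation theorem a bounded operator has exactly one
   adjoint, so that the default value of [xget] is irrelevant for those. *)
Definition adj T : op := xget (\0 : op) [set S | is_adjoint T S].

Definition unitary u :=
  [/\ bounded_op u, u \o adj u = id & adj u \o u = id].

Definition Ad u T : op := u \o T \o adj u.

Definition commutant X : set op :=
  [set T | bounded_op T /\ forall S, X S -> T \o S = S \o T].

Definition star_subalgebra M :=
  [/\ M `<=` bounded_op, M (\0 : op),
      (forall (k : R[i]) T S, M T -> M S -> M (k *: T + S)),
      (forall T S, M T -> M S -> M (T \o S)) &
      (forall T, M T -> M (adj T))].

Definition norm_closed M :=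
  forall T, bounded_op T ->
    (forall e : R[i], 0 < e ->
       exists2 S, M S & forall x, `|T x - S x| <= e * `|x|) ->
    M T.

Definition is_Cstar_algebra M := star_subalgebra M /\ norm_closed M.

Definition is_vN_algebra M :=
  star_subalgebra M /\ commutant (commutant M) = M.

(* xi is in the domain of the self-adjoint generator K of the one-parameter
   group V(t) = exp(itK), and K xi = eta *)
Definition generator_graph (V : R -> op) (xi eta : H) :=
  (fun t : R => (((0 +i* t)%C : R[i])^-1) *: (V t xi - xi)) @ 0^' --> eta.

Definition positive_generator (V : R -> op) :=
  forall xi eta, generator_graph V xi eta -> 0 <= inner H xi eta.

Definition cyclic_vector X (v : H) :=
  dense [set T v | T in smallest star_subalgebra X].

(* the group has carrier D, product mul and unit e *)
Definition unitary_rep (G : topologicalType) (D : set G)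
    (mul : G -> G -> G) (e : G) (V : G -> op) :=
  [/\ forall g, D g -> unitary (V g),
      V e = id,
      forall g h, D g -> D h -> V (mul g h) = V g \o V h &
      forall x, {within D, continuous (fun g => V g x)}].

End Operators.

Section Moebius.
Context {R : realType}.

(* elements of PSL(2,R) are represented by matrices in SL(2,R), up to sign *)
Definition SL2 : set 'M[R]_2 := [set g | \det g = 1].

Definition mx2 (a b c d : R) : 'M[R]_2 :=
  \matrix_(i, j) if i == 0 then (if j == 0 then a else b)
                 else (if j == 0 then c else d).

(* x |-> (a x + b) / (c x + d) on the real line with a point at infinity *)
Definition moebius (g : 'M[R]_2) (x : one_point_compactification R) :
    one_point_compactification R :=
  let: (a, b, c, d) := (g 0 0, g 0 1, g 1 0, g 1 1) in
  match x with
  | Some x => if c * x + d == 0 then None else Some ((a * x + b) / (c * x + d))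
  | None => if c == 0 then None else Some (a / c)
  end.

Definition moves (g : 'M[R]_2) (I J : set R) :=
  moebius g @` (Some @` I) = Some @` J.

(* the line identified with the circle by x = tan (theta / 2) *)
Definition circle_proj (theta : R) : one_point_compactification R :=
  if cos (theta / 2) == 0 then None else Some (tan (theta / 2)).

(* theta |-> theta + t on the circle *)
Definition rotation (t : R) : 'M[R]_2 :=
  mx2 (cos (t / 2)) (sin (t / 2)) (- sin (t / 2)) (cos (t / 2)).

Definition lifts (phi : R -> R) (g : 'M[R]_2) :=
  forall theta, circle_proj (phi theta) = moebius g (circle_proj theta).

(* The universal covering group of PSL(2,R): the lifts of the Moebius
   transformations of the circle to its universal covering R, with the
   composition of functions and the compact-open topology. *)
Definition moebius_cover : set {compact-open, R -> R} :=
  [set phi | continuous (phi : R -> R) /\ exists2 g, SL2 g & lifts phi g].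

Definition cover_comp (phi psi : {compact-open, R -> R}) :
  {compact-open, R -> R} := (phi : R -> R) \o (psi : R -> R).

Definition cover_id : {compact-open, R -> R} := (id : R -> R).

End Moebius.

Section Nets.
Context {R : realType} {H : hilbertSpace R}.
Local Notation op := (H -> H).

Definition bounded_intervals : set (set R) :=
  [set I | exists a b, a < b /\ I = `]a, b[%classic].

Definition half_lines : set (set R) :=
  [set W | exists a, W = `]a, +oo[%classic \/ W = `]-oo, a[%classic].

Definition causal_complement (S : set R) : set R := ~` closure S.

(* [local_algebra] is only meaningful on bounded open intervals, and [moeb]
   only on SL(2,R), where it is a representation of PSL(2,R). *)
Record conformal_net := ConformalNet {
  local_algebra : set R -> set op ;
  moeb : 'M[R]_2 -> op ;
  vacuum : H ;
  net_separable : exists2 D : set H, countable D & dense D ;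
  net_vN : forall I, bounded_intervals I -> is_vN_algebra (local_algebra I) ;
  net_rep : unitary_rep SL2 mulmx 1%:M moeb ;
  net_repN : forall g, SL2 g -> moeb (- g) = moeb g ;
  net_isotony : forall I J, bounded_intervals I -> bounded_intervals J ->
    I `<=` J -> local_algebra I `<=` local_algebra J ;
  net_locality : forall I J, bounded_intervals I -> bounded_intervals J ->
    I `&` J = set0 -> forall S T, local_algebra I S -> local_algebra J T ->
    S \o T = T \o S ;
  net_covariance : forall g I J, SL2 g ->
    bounded_intervals I -> bounded_intervals J -> moves g I J ->
    [set Ad (moeb g) T | T in local_algebra I] = local_algebra J ;
  net_positive_energy : positive_generator (fun t => moeb (rotation t)) ;
  vacuum_neq0 : vacuum != 0 ;
  vacuum_invariant : forall g, SL2 g -> moeb g vacuum = vacuum ;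
  vacuum_unique : forall v, (forall g, SL2 g -> moeb g v = v) ->
    exists c : R[i], v = c *: vacuum ;
  vacuum_cyclic : cyclic_vector
    (\bigcup_(I in bounded_intervals) local_algebra I `|` moeb @` SL2) vacuum }.

End Nets.
Arguments conformal_net {R} H.

Section NetAlgebras.
Context {R : realType} {H : hilbertSpace R}.
Local Notation op := (H -> H).
Variable N : conformal_net H.

Definition net_algebra (S : set R) : set op :=
  let generators :=
    \bigcup_(I in [set I | bounded_intervals I /\ I `<=` S]) local_algebra N I in
  if `[< bounded_set S >] then smallest is_vN_algebra generators
  else smallest is_Cstar_algebra generators.

Definition quasilocal : set op := net_algebra setT.

Definition Haag_duality :=
  forall I, bounded_intervals I ->
    commutant (net_algebra (causal_complement I)) = local_algebra N I.

Record endomorphism := Endomorphism {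
  endo_fun :> quasilocal -> quasilocal ;
  endo_linear : forall (k : R[i]) (a b c : quasilocal),
    val c = k *: val a + val b ->
    val (endo_fun c) = k *: val (endo_fun a) + val (endo_fun b) ;
  endo_mul : forall a b c : quasilocal, val c = val a \o val b ->
    val (endo_fun c) = val (endo_fun a) \o val (endo_fun b) ;
  endo_star : forall a b : quasilocal, val b = adj (val a) ->
    val (endo_fun b) = adj (val (endo_fun a)) ;
  endo_unital : forall a : quasilocal, val a = id -> val (endo_fun a) = id }.

Implicit Types (rho sigma tau : endomorphism).

Definition acts_trivially_on (X : set op) (f : quasilocal -> op) :=
  forall a : quasilocal, X (val a) -> f a = val a.

Definition localizable (f : quasilocal -> op) (S : set R) :=
  forall J, bounded_intervals J -> J `<=` causal_complement S ->
    acts_trivially_on (local_algebra N J) f.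

Definition localizable_endo rho S := localizable (fun a => val (rho a)) S.

Definition transportable rho :=
  forall J, bounded_intervals J ->
    exists u, [/\ quasilocal u, unitary u &
                  localizable (fun a => Ad u (val (rho a))) J].

(* rho (U(g) a U(g)^* ) = V(g) rho(a) V(g)^*  for a in A(I) and g in the
   covering group, whenever I and gI are bounded intervals of the line *)
Definition moebius_covariant rho :=
  exists2 V : {compact-open, R -> R} -> op,
    unitary_rep moebius_cover cover_comp cover_id V &
    forall phi g I J, moebius_cover phi -> SL2 g -> lifts phi g ->
      bounded_intervals I -> bounded_intervals J -> moves g I J ->
      forall a b : quasilocal, local_algebra N I (val a) ->
        val b = Ad (moeb N g) (val a) ->
        val (rho b) = Ad (V phi) (val (rho a)).

Definition Hom rho sigma : set op :=
  [set t | quasilocal t /\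
           forall a, t \o val (rho a) = val (sigma a) \o t].

Definition irreducible rho :=
  forall t, Hom rho rho t -> exists c : R[i], t = c *: (id : op).

Definition superselection rho :=
  (exists2 I, bounded_intervals I & localizable_endo rho I) /\
  transportable rho.

(* rho is a finite direct sum of irreducibles: there are isometries t_i in
   Hom(sigma_i, rho) with orthogonal ranges adding up to 1 *)
Definition finitely_reducible rho :=
  exists (n : nat) (sigma : 'I_n -> endomorphism) (t : 'I_n -> op),
    [/\ forall i, superselection (sigma i) /\ irreducible (sigma i),
        forall i, Hom (sigma i) rho (t i),
        forall i j, adj (t i) \o t j = (if i == j then id else \0) &
        \sum_i (t i \o adj (t i)) = id].

Definition DHR_endo : set endomorphism :=
  [set rho | [/\ superselection rho, moebius_covariant rho &
                 finitely_reducible rho]].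

(* subcategories of the category DHR{A}, which has the objects [DHR_endo], the
   arrows [Hom] and the composition of operators *)
Record DHR_subcategory := DHRSubcategory {
  sub_obj : set endomorphism ;
  sub_hom : endomorphism -> endomorphism -> set op ;
  sub_obj_DHR : sub_obj `<=` DHR_endo ;
  sub_homP : forall rho sigma t, sub_hom rho sigma t ->
    [/\ sub_obj rho, sub_obj sigma & Hom rho sigma t] ;
  sub_id : forall rho, sub_obj rho -> sub_hom rho rho id ;
  sub_comp : forall rho sigma tau s t,
    sub_hom rho sigma t -> sub_hom sigma tau s -> sub_hom rho tau (s \o t) }.

Lemma quasilocalE : quasilocal = smallest is_Cstar_algebra
  (\bigcup_(I in bounded_intervals) local_algebra N I).
Proof.
rewrite /quasilocal /net_algebra asboolF; last first.
  case=> M [_ /(_ (`|M| + 1))].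
  rewrite (le_lt_trans (ler_norm M)) ?ltrDl// => /(_ isT (`|M| + 2) I).
  by rewrite /= ger0_norm ?addr_ge0// lerD2l leNgt ltr1n.
by congr (smallest _ (bigcup _ _)); apply/seteqP; split=> [J []|J].
Qed.

Lemma quasilocal_id : quasilocal id.
Proof.
rewrite quasilocalE => M [_]; apply; exists `]0, 1[%classic; first by exists 0, 1.
have [_ <-] : is_vN_algebra (local_algebra N `]0, 1[%classic).
  by apply: net_vN; exists 0, 1.
split=> [|S _]; last exact/funext.
by split=> // x.
Qed.

Lemma quasilocal_comp S T : quasilocal S -> quasilocal T -> quasilocal (S \o T).
Proof.
rewrite quasilocalE => AS AT M MX; have [[[_ _ _ + _] _] _] := MX.
by apply; [exact: AS|exact: AT].
Qed.

Definition full_hom (P : set endomorphism) rho sigma : set op :=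
  [set t | [/\ (DHR_endo `&` P) rho, (DHR_endo `&` P) sigma & Hom rho sigma t]].

Lemma full_id P rho : (DHR_endo `&` P) rho -> full_hom P rho rho id.
Proof. by move=> Pr; split=> //; split=> //; exact: quasilocal_id. Qed.

Lemma full_comp P rho sigma tau s t :
  full_hom P rho sigma t -> full_hom P sigma tau s ->
  full_hom P rho tau (s \o t).
Proof.
move=> [Pr _ [At ht]] [_ Pt [As hs]]; split=> //; split.
  exact: quasilocal_comp.
by move=> a; rewrite -compA ht compA hs.
Qed.

Definition full_subcategory (P : set endomorphism) : DHR_subcategory :=
  @DHRSubcategory (DHR_endo `&` P) (full_hom P) (@subIsetl _ _ _)
    (fun _ _ _ h => h) (@full_id P) (@full_comp P).

Definition dual (X : set op) : DHR_subcategory :=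
  full_subcategory [set rho | acts_trivially_on X (fun a => val (rho a))].

Definition DHR_localizable (S : set R) : DHR_subcategory :=
  full_subcategory [set rho | localizable_endo rho S].

End NetAlgebras.

(* Main.v *)
(* Since W'' = W, localizability of rho in W' means that rho fixes the algebras
   of the bounded intervals contained in W.  The fixed points of rho form a
   C*-algebra, so they then contain the one generated by these algebras.  They
   are norm closed because rho is norm bounded: if |a|^2 <= 1/2, then 1 - a* a
   has a self-adjoint square root s in the quasilocal algebra, and
   |v|^2 - |rho a v|^2 = |rho s v|^2 >= 0.  The square root is the limit of a
   contracting iteration, and adjoints exist by the Riesz representation
   theorem. *)
Require Import Defs.
From HB Require Import structures.
From mathcomp Require Import all_boot all_order all_algebra.
From mathcomp Require Import all_classical all_reals all_analysis.
From mathcomp.real_closed Require Import complex.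
From mathcomp Require Import ring lra.

Set Implicit Arguments.
Unset Strict Implicit.
Unset Printing Implicit Defensive.

Import Order.TTheory GRing.Theory Num.Theory.
Import numFieldNormedType.Exports.

Local Open Scope classical_set_scope.
Local Open Scope ring_scope.

(** * Geometric error bounds and infima in the partially ordered field [R[i]] *)

Section ComplexBounds.
Variable R : realType.
Implicit Types a b c e : R[i].

Lemma half_exp_small c e : 0 <= c -> 0 < e -> exists n, c * 2^-1 ^+ n < e.
Proof.
move=> c0 e0; have := divr_ge0 c0 (ltW e0); set d := c / e => d0.
exists (Num.bound (complex.Re d)).
have : d < 2 ^+ (Num.bound (complex.Re d)).
  have dE : d = (complex.Re d)%:C%C.
    by case: (d) (ger0_Im d0) => r s /= ->.
  rewrite {1}dE.
  rewrite (_ : 2 ^+ _ = (2 ^+ (Num.bound (complex.Re d)))%:C%C); last first.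
    by rewrite rmorphXn rmorph_nat.
  by rewrite ltcR; apply: upper_nthrootP.
by rewrite /d ltr_pdivrMr// exprVn ltr_pdivrMr ?exprn_gt0// mulrC.
Qed.

Lemma ler_half_exp a b c :
  0 <= c -> (forall n, a <= b + c * 2^-1 ^+ n) -> a <= b.
Proof.
move=> c0 h; apply/ler_addgt0Pr => e e0.
have [n ne] := half_exp_small c0 e0.
by rewrite (le_trans (h n))// lerD2l ltW.
Qed.

(** Identities between limits are proved below in this form: their defect is bounded by a fixed
    multiple of 2^-n for every n. The case n = 0 gives 0 <= c. *)
Lemma norm_half_exp_eq0 (V : normedZmodType R[i]) (v : V) c :
  (forall n, `|v| <= c * 2^-1 ^+ n) -> v = 0.
Proof.
move=> h; apply/eqP; rewrite -normr_le0; apply: (@ler_half_exp _ _ c).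
  by have := h 0%N; rewrite expr0 mulr1; apply: le_trans.
by move=> n; rewrite add0r.
Qed.

(** A lower bound b in [R[i]] forces all values of q to have the imaginary part of b, so the infimum
    can be taken over the real parts. The point t makes that set nonempty. *)
Lemma near_minimizer (T : Type) (t : T) (q : T -> R[i]) b :
  (forall x, b <= q x) ->
  forall e, 0 < e -> exists x, forall y, q x <= q y + e.
Proof.
move=> qb [r s]; rewrite ltcE /= => /andP[/eqP -> r0].
pose E := [set complex.Re (q x) | x in setT].
have lbE : has_lbound E.
  by exists (complex.Re b) => _ [x _ <-]; have := qb x; rewrite lecE => /andP[].
have [|_ [x _ <-] xr] := @inf_adherent _ E r r0.
  by split=> //; exists (complex.Re (q t)), t.
exists x => y; rewrite lecE /=.
have Imq z : complex.Im (q z) = complex.Im b.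
  by have := qb z; rewrite lecE => /andP[/eqP].
have := Imq x; have := Imq y.
have : inf E <= complex.Re (q y) by apply: ge_inf => //; exists y.
case: (q x) xr => [u v] /= xr; case: (q y) => [u' v'] /= Ey -> ->.
by rewrite addr0 eqxx /= (le_trans (ltW xr))// lerD2r.
Qed.

End ComplexBounds.

(** * Hilbert space geometry, the Riesz representation and adjoints *)

Section HilbertSpaces.
Context {R : realType} {H : hilbertSpace R}.
Local Notation C := R[i].
Local Notation "'[ x , y ]" := (inner H x y).
Implicit Types (x y z : H) (a c d e : C) (S T : H -> H).

Lemma innerC x y : '[x, y] = ('[y, x])^*.
Proof. by rewrite hermC expr0 mul1r. Qed.

Lemma innerZr c x y : '[x, c *: y] = c^* * '[x, y].
Proof. by rewrite linearZr_LR. Qed.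

Lemma innerZl c x y : '[c *: x, y] = c * '[x, y].
Proof. by rewrite linearZl_LR. Qed.

Lemma innerDl x y z : '[x + y, z] = '[x, z] + '[y, z].
Proof. exact: linearDl. Qed.

Lemma innerDr x y z : '[x, y + z] = '[x, y] + '[x, z].
Proof. exact: linearDr. Qed.

Lemma innerBl x y z : '[x - y, z] = '[x, z] - '[y, z].
Proof. exact: linearBl. Qed.

Lemma innerBr x y z : '[x, y - z] = '[x, y] - '[x, z].
Proof. exact: linearBr. Qed.

Lemma inner_injl x y : (forall z, '[x, z] = '[y, z]) -> x = y.
Proof.
move=> xy; apply/eqP; rewrite -subr_eq0 -(dnorm_eq0 (inner H)).
by rewrite innerBl xy subrr.
Qed.

Lemma inner_injr x y : (forall z, '[z, x] = '[z, y]) -> x = y.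
Proof. by move=> xy; apply: inner_injl => z; rewrite innerC xy -innerC. Qed.

Lemma cauchy_schwarz x y : `|'[x, y]| <= `|x| * `|y|.
Proof.
have [->|y0] := eqVneq y 0; first by rewrite linear0r !normr0 mulr0.
have yy0 : 0 < '[y, y] by rewrite dnorm_gt0.
(* The vector a y is the orthogonal projection of x onto the line of y. The inequality is |x - a
   y|^2 >= 0, expanded. *)
pose a := '[x, y] / '[y, y].
have aJ : a^* = '[y, x] / '[y, y].
  rewrite rmorphM rmorphV ?unitfE ?gt_eqF//= -innerC.
  by congr (_ / _); rewrite -innerC.
have dJ : ('[y, x] / '[y, y] * '[x, y])^* = a * '[y, x].
  by rewrite rmorphM /= -aJ conjCK -innerC.
have := dnorm_ge0 (inner H) (x - a *: y).
rewrite dnormB dnormZ innerZr aJ dJ /a.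
rewrite normrM exprMn normfV (gtr0_norm yy0).
move: yy0; rewrite -!inner_norm => n0.
have -> : `|x| ^+ 2 + `|'[x, y]| ^+ 2 * `|y| ^- 2 ^+ 2 * `|y| ^+ 2 -
    ('[y, x] / `|y| ^+ 2 * '[x, y] + '[x, y] / `|y| ^+ 2 * '[y, x]) =
    `|x| ^+ 2 - `|'[x, y]| ^+ 2 / `|y| ^+ 2.
  have : `|y| != 0 by rewrite normr_eq0.
  rewrite normCK -innerC.
  move: (`|y|) (`|x|) '[x, y] '[y, x] => u v s t u0.
  by field.
by rewrite subr_ge0 ler_pdivrMr// -exprMn ler_pXn2r// nnegrE// mulr_ge0.
Qed.

Lemma cauchy_complete (x : nat -> H) c :
  (forall m n, (n <= m)%N -> `|x m - x n| <= c * 2^-1 ^+ n) ->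
  exists z, forall n, `|z - x n| <= c * 2^-1 ^+ n.
Proof.
move=> xc.
have c0 : 0 <= c.
  by have := xc 0 0 (leqnn 0); rewrite expr0 mulr1; apply: le_trans.
have/cvg_ex[z xz] : cvg (x @ \oo).
  apply: cauchy_cvg; apply: cauchy_exP => e e0.
  have [n ne] := half_exp_small c0 e0.
  exists (x n); exists n => //= m nm.
  by rewrite -ball_normE /= distrC (le_lt_trans (xc _ _ nm)).
exists z => n; apply/ler_addgt0Pr => e e0.
have [N _ Nz] : \forall m \near \oo, `|z - x m| < e.
  by move/cvgrPdist_lt : xz; exact.
have zN := Nz (maxn N n) (leq_maxl _ _).
rewrite (le_trans (ler_distD (x (maxn N n)) _ _))// addrC lerD//.
  exact: xc (leq_maxr _ _).
exact: ltW.
Qed.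

(* An e^2-minimizer x of |x|^2 - 2 Re (f x) represents f up to an error e. *)
Lemma riesz_approx (f : H -> C) M :
  (forall a x y, f (a *: x + y) = a * f x + f y) ->
  0 <= M -> (forall x, `|f x| <= M * `|x|) ->
  forall e, 0 < e -> exists x, forall h, `|'[h, x] - f h| <= e * `|h|.
Proof.
move=> fD M0 fM e e0; pose q x := `|x| ^+ 2 - (f x + (f x)^*).
have [||x xmin] := @near_minimizer _ _ (0 : H) q (- M ^+ 2) _ (e ^+ 2).
(* Since 2 Re (f x) <= 2 M |x|, the value q x + M^2 is at least (|x| - M)^2. *)
- move=> x; rewrite -subr_ge0 /q.
  have fR : f x + (f x)^* <= 2 * (M * `|x|).
    have fr : f x + (f x)^* \is Num.real.
      by rewrite CrealE rmorphD /= conjCK addrC.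
    rewrite (le_trans (real_ler_norm fr))// (le_trans (ler_normD _ _))//.
    by rewrite norm_conjC mulr_natl mulr2n lerD.
  have sq : 0 <= `|x| ^+ 2 + M ^+ 2 - 2 * (M * `|x|).
    have -> : `|x| ^+ 2 + M ^+ 2 - 2 * (M * `|x|) = (`|x| - M) ^+ 2 by ring.
    by rewrite real_exprn_even_ge0// realB// ger0_real.
  rewrite opprK addrAC (le_trans sq)//.
  by rewrite lerD2l lerN2.
- by rewrite exprn_gt0.
exists x => h; have [->|h0] := eqVneq h 0.
  have := fD 1 0 0; rewrite scale1r addr0 mul1r.
  move=> /(congr1 (fun u => u - f 0)); rewrite addrK subrr => <-.
  by rewrite linear0l subr0 !normr0 mulr0.
have nh0 : 0 < `|h| by rewrite normr_gt0.
(* This b minimizes q (b h + x), lowering q x by exactly |D|^2 / |h|^2. Near-minimality of x then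
   gives |D|^2 / |h|^2 <= e^2. *)
set D := '[h, x] - f h; pose b : C := - D^* / `|h| ^+ 2.
have := xmin (b *: h + x); rewrite /q fD inner_norm inner_norm.
rewrite dnormD dnormZ innerZl -inner_norm -inner_norm.
have bJ : b^* = - D / `|h| ^+ 2.
  rewrite /b rmorphM rmorphN /= conjCK rmorphV ?unitfE ?expf_neq0 ?gt_eqF//=.
  by congr (_ / _); apply/CrealP; rewrite rpredX// normr_real.
have mulbJ u : (b * u)^* = - D / `|h| ^+ 2 * u^*.
  by rewrite [LHS]rmorphM; congr (_ * _); exact: bJ.
have fbJ : (b * f h + f x)^* = - D / `|h| ^+ 2 * (f h)^* + (f x)^*.
  by rewrite [LHS]rmorphD; congr (_ + _); exact: mulbJ.
have hxJ : '[h, x]^* = D^* + (f h)^* by rewrite [D^*]rmorphB subrK.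
rewrite normCK bJ mulbJ fbJ hxJ.
have -> : '[h, x] = D + f h by rewrite subrK.
rewrite /b -subr_ge0.
have nh : `|h| != 0 by rewrite gt_eqF.
set l := _ - _; have {l} -> : l = e ^+ 2 - D * D^* / `|h| ^+ 2.
  rewrite /l; clearbody D; clear -nh.
  move: D (f x) (f h) (f x)^* (f h)^* D^* => u v s t u1 v1.
  by field.
rewrite -normCK subr_ge0 ler_pdivrMr ?exprn_gt0// -exprMn.
by rewrite ler_pXn2r// nnegrE// mulr_ge0// ltW.
Qed.

Lemma linear_packed T :
  linear T -> exists L : {linear H -> H}, T = L :> (H -> H).
Proof.
move=> lT.
by exists (HB.pack_for {linear H -> H} T (GRing.isLinear.Build _ _ _ _ T lT)).
Qed.

(** The approximate representatives x n with error 2^-n form a Cauchy sequence: for d = x m - x n,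
    both inner products of d with x m and x n are close to f d, so |d|^2 is at most 2 * 2^-n |d|.
    The limit represents f exactly. *)
Lemma riesz (f : H -> C) M :
  (forall a x y, f (a *: x + y) = a * f x + f y) ->
  0 <= M -> (forall x, `|f x| <= M * `|x|) ->
  exists z, forall h, f h = '[h, z].
Proof.
move=> fD M0 fM; have half_gt0 n : 0 < 2^-1 ^+ n :> C by rewrite exprn_gt0.
have /choice[x xP] n := riesz_approx fD M0 fM (half_gt0 n).
have [|z zP] := @cauchy_complete x 2.
  move=> m n nm; set d := x m - x n; have [->|d0] := eqVneq d 0.
    by rewrite normr0 mulr_ge0// ltW.
  have nd0 : 0 < `|d| by rewrite normr_gt0.
  rewrite -(ler_pM2r nd0) -expr2 inner_norm {2}/d innerBr.
  rewrite -(ger0_norm (_ : 0 <= '[d, x m] - '[d, x n])); last first.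
    by rewrite -innerBr -inner_norm exprn_ge0.
  rewrite (le_trans (ler_distD (f d) _ _))// mulr_natl mulr2n mulrDl lerD//.
    rewrite (le_trans (xP _ _))// ler_wpM2r//.
    by rewrite ler_wiXn2l// ?invr_ge0// invf_le1// ler1n.
  by rewrite distrC.
exists z => h; apply/eqP; rewrite -subr_eq0; apply/eqP.
apply: (@norm_half_exp_eq0 _ _ _ (3 * `|h|)) => n.
rewrite (le_trans (ler_distD '[h, x n] _ _))//.
rewrite (_ : 3 * _ * _ = 2^-1 ^+ n * `|h| + `|h| * (2 * 2^-1 ^+ n));
  last by ring.
rewrite lerD//; first by rewrite distrC.
rewrite -innerBr (le_trans (cauchy_schwarz _ _))// ler_wpM2l//.
by rewrite distrC.
Qed.

Lemma bounded_opP T :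
  bounded_op T <->
  linear T /\ exists2 c, 0 <= c & forall x, `|T x| <= c * `|x|.
Proof.
split=> [[lT cT]|[lT [c c0 Tc]]]; split=> //; have [L TL] := linear_packed lT.
- have /linear_boundedP[c [cr cP]] : bounded_near L (nbhs (0 : H)).
    by apply/linear_bounded_continuous; rewrite -TL.
  exists (`|c| + 1) => [|x]; first by rewrite addr_ge0.
  rewrite TL; apply: cP.
  by rewrite (le_lt_trans (real_ler_norm cr))// ltrDl.
- rewrite TL; apply/linear_bounded_continuous/linear_boundedP.
  exists c; split=> [|r cr x]; first exact: ger0_real.
  by rewrite -TL (le_trans (Tc x))// ler_wpM2r// ltW.
Qed.

Lemma bounded_opN T c : linear T -> 0 <= c ->
  (forall x, `|T x| <= c * `|x|) -> bounded_op T.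
Proof. by move=> lT c0 Tc; apply/bounded_opP; split=> //; exists c. Qed.

Lemma linear_sub T x y : linear T -> T (x - y) = T x - T y.
Proof. by move=> /linear_packed[L ->]; rewrite linearB. Qed.

Lemma is_adjoint_sym T S : is_adjoint T S -> is_adjoint S T.
Proof. by move=> h x y; rewrite innerC -h -innerC. Qed.

(** Once some adjoint exists, [xget] returns an adjoint, and nondegeneracy of the inner product
    leaves only one. *)
Lemma adjE T S : is_adjoint T S -> adj T = S.
Proof.
move=> TS.
have aT : is_adjoint T (adj T) by apply: (@xgetI _ (\0 : H -> H) _ S).
by apply/funext => y; apply: inner_injr => x; rewrite -aT -TS.
Qed.

Lemma adj_bounded T :
  bounded_op T -> is_adjoint T (adj T) /\ bounded_op (adj T).
Proof.
move=> /bounded_opP[lT [c c0 Tc]].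
have /choice[S TS] : forall y, exists z, forall x, '[T x, y] = '[x, z].
  move=> y; apply: (@riesz _ (c * `|y|)) => [a u v||x].
  - by rewrite lT innerDl innerZl.
  - by rewrite mulr_ge0.
  - by rewrite (le_trans (cauchy_schwarz _ _))// mulrAC ler_wpM2r.
have {}TS : is_adjoint T S by [].
rewrite (adjE TS); split=> //; apply: (@bounded_opN _ c) => // [a u v|y].
  by apply: inner_injr => x; rewrite innerDr innerZr -!TS innerDr innerZr.
have [->|Sy0] := eqVneq (S y) 0; first by rewrite normr0 mulr_ge0.
have nSy : 0 < `|S y| by rewrite normr_gt0.
(* The bound c of T carries over to S: |S y|^2 is the inner product of T (S y) and y, hence at most
   c |S y| |y|, and |S y| cancels. *)
rewrite -(ler_pM2l nSy) -expr2 inner_norm -TS.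
rewrite -[leLHS]ger0_norm; last by rewrite TS -inner_norm exprn_ge0.
rewrite (le_trans (cauchy_schwarz _ _))// mulrA ler_wpM2r// mulrC; exact: Tc.
Qed.

Lemma adj_adjoint T : bounded_op T -> is_adjoint T (adj T).
Proof. by case/adj_bounded. Qed.

Lemma operator_complete (T : nat -> H -> H) :
  (forall n, linear (T n)) ->
  (forall m n, (n <= m)%N -> forall x, `|T m x - T n x| <= 2^-1 ^+ n * `|x|) ->
  exists2 S, linear S & forall n x, `|S x - T n x| <= 2^-1 ^+ n * `|x|.
Proof.
move=> lT Tc.
have /choice[S ST] : forall x,
    exists z, forall n, `|z - T n x| <= `|x| * 2^-1 ^+ n.
  by move=> x; apply: cauchy_complete => m n nm; rewrite mulrC Tc.
exists S => [a u v|n x]; last by rewrite mulrC.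
apply/eqP; rewrite -subr_eq0; apply/eqP.
apply: (@norm_half_exp_eq0 _ _ _ (`|a *: u + v| + `|a| * `|u| + `|v|)) => n.
(* As T n is linear, the linearity defect of the pointwise limit S is a combination of three
   approximation errors of order 2^-n. *)
have -> : S (a *: u + v) - (a *: S u + S v) =
    (S (a *: u + v) - T n (a *: u + v)) - a *: (S u - T n u) - (S v - T n v).
  rewrite lT -(addrA (_ - _)) -opprD [in RHS]scalerBr.
  rewrite [X in _ = _ - X]addrACA -(opprD _ (T n v)) opprB addrA.
  by rewrite subrK.
rewrite !mulrDl (le_trans (ler_normB _ _))// lerD//.
rewrite (le_trans (ler_normB _ _))// lerD// normrZ -mulrA ler_wpM2l//.
Qed.

(** * Norm-closed star subalgebras *)

Section StarSubalgebra.
Variable A : set (H -> H).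
Hypotheses (sA : star_subalgebra A) (cA : norm_closed A).

Lemma star_bounded T : A T -> bounded_op T.
Proof. by have [AB _ _ _ _] := sA; exact: AB. Qed.

Lemma star_linear T : A T -> linear T.
Proof. by move=> /star_bounded[]. Qed.

Lemma star_scale c T : A T -> A (c *: T).
Proof.
have [_ A0 AD _ _] := sA.
by move=> AT; have := AD c T _ AT A0;
  rewrite [X in A X](_ : _ = c *: T)// addr0.
Qed.

Lemma star_add T S : A T -> A S -> A (T + S).
Proof.
have [_ _ AD _ _] := sA.
by move=> AT AS; have := AD 1 T S AT AS; rewrite scale1r.
Qed.

Lemma star_mul T S : A T -> A S -> A (T \o S).
Proof. by have [_ _ _ + _] := sA; apply. Qed.

(** * The square root of 1 - t for self-adjoint t of norm at most 1/2 *)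

Section SquareRoot.
Variable t : H -> H.
Hypotheses (At : A t) (t_half : forall x, `|t x| <= 2^-1 * `|x|).
Hypothesis t_adj : is_adjoint t t.

Local Notation G := (fun y : H -> H => (2^-1 : C) *: (t + (y \o y))).
Local Notation Y := (fun n => iter n G (\0 : H -> H)).

Let half_ge0 : 0 <= 2^-1 :> C. Proof. by rewrite invr_ge0. Qed.

Let GE (y : H -> H) x : G y x = 2^-1 *: (t x + y (y x)). Proof. by []. Qed.

(** The iteration preserves the ball of radius 1/2, because |t| <= 1/2 and |y^2| <= 1/4 <= 1/2. *)
Lemma sqrt_step_half (y : H -> H) : (forall x, `|y x| <= 2^-1 * `|x|) ->
  forall x, `|G y x| <= 2^-1 * `|x|.
Proof.
move=> yx x; rewrite normrZ ger0_norm// ler_wpM2l//.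
rewrite (le_trans (ler_normD _ _))// [leRHS](splitr `|x|) lerD//.
  by rewrite mulrC.
rewrite (le_trans (yx _))// (mulrC `|x|) ler_wpM2l// (le_trans (yx x))//.
by rewrite ler_piMl// invf_le1// ler1n.
Qed.

(** Write y^2 - z^2 = (y - z) y + z (y - z). On the ball of radius 1/2 each term is at most c/2, and
    the factor 1/2 in [G] halves their sum. *)
Lemma sqrt_step_contract (y z : H -> H) c : 0 <= c -> linear z ->
  (forall x, `|y x| <= 2^-1 * `|x|) -> (forall x, `|z x| <= 2^-1 * `|x|) ->
  (forall x, `|y x - z x| <= c * `|x|) ->
  forall x, `|G y x - G z x| <= c * 2^-1 * `|x|.
Proof.
move=> c0 lz yb zb yz x.
have -> : G y x - G z x = 2^-1 *: ((y (y x) - z (y x)) + z (y x - z x)).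
  by rewrite !GE linear_sub// -scalerBr opprD addrACA subrr add0r addrA subrK.
rewrite normrZ ger0_norm// mulrC -mulrA (mulrC _ `|x|) mulrA ler_wpM2r//.
rewrite (le_trans (ler_normD _ _))// [leRHS](splitr (c * `|x|)) lerD//.
  by rewrite (le_trans (yz _))// -mulrA ler_wpM2l// mulrC.
by rewrite (le_trans (zb _))// mulrC ler_wpM2r.
Qed.

Lemma sqrt_iter_half n x : `|Y n x| <= 2^-1 * `|x|.
Proof.
elim: n x => [|n IH] x; last exact: sqrt_step_half.
by rewrite /= normr0 mulr_ge0.
Qed.

Lemma sqrt_iter_in n : A (Y n).
Proof.
elim: n => [|n IH]; first by have [] := sA.
by apply/star_scale/star_add => //; apply: star_mul.
Qed.

Lemma sqrt_iter_adj n : is_adjoint (Y n) (Y n).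
Proof.
elim: n => [|n IH] x y; first by rewrite /= linear0l linear0r.
rewrite /= innerZl innerZr innerDl innerDr t_adj !IH; congr (_ * _).
by apply/esym/CrealP; rewrite ger0_real.
Qed.

Lemma sqrt_iter_cauchy m n : (n <= m)%N ->
  forall x, `|Y m x - Y n x| <= 2^-1 ^+ n * `|x|.
Proof.
elim: n m => [|n IH] [|m]// nm x.
- by rewrite /= subrr normr0 mulr_ge0.
- rewrite [Y 0 x]/= subr0 expr0 mul1r (le_trans (sqrt_iter_half _ _))//.
  by rewrite ler_piMl// invf_le1// ler1n.
- rewrite exprSr; apply: sqrt_step_contract.
  + exact: exprn_ge0.
  + exact/star_linear/sqrt_iter_in.
  + exact: sqrt_iter_half.
  + exact: sqrt_iter_half.
  + exact: IH.
Qed.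

(* 1 - sqrt (1 - t) is the fixed point of the contraction
   y |-> (t + y^2) / 2. *)
Lemma sqrt_fixpoint :
  exists y : H -> H, [/\ A y, is_adjoint y y &
    forall x, y x = 2^-1 *: (t x + y (y x))].
Proof.
have lY n : linear (Y n) by exact/star_linear/sqrt_iter_in.
have [y ly yP] := operator_complete lY sqrt_iter_cauchy.
have y_half x : `|y x| <= 2^-1 * `|x|.
  apply: (@ler_half_exp _ _ _ `|x|) => // n.
  rewrite -[y x](subrK (Y n x)) (le_trans (ler_normD _ _))// addrC lerD//.
    exact: sqrt_iter_half.
  by rewrite mulrC yP.
exists y; split.
- apply: cA => [|e e0]; first exact: bounded_opN y_half.
  (* The limit is in [A] by norm closedness, since every iterate is. *)
  have [n ne] := @half_exp_small _ 1 e ler01 e0.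
  exists (Y n) => [|x]; first exact: sqrt_iter_in.
  by rewrite (le_trans (yP n x))// ler_wpM2r// ltW// -[ltLHS]mul1r.
- move=> u v; apply/eqP; rewrite -subr_eq0; apply/eqP.
  apply: (@norm_half_exp_eq0 _ _ _ (2 * (`|u| * `|v|))) => n.
  have -> : '[y u, v] - '[u, y v] = '[y u - Y n u, v] - '[u, y v - Y n v].
    by rewrite innerBl innerBr sqrt_iter_adj opprB addrA subrK.
  rewrite (le_trans (ler_normB _ _))// mulr_natl mulr2n mulrDl lerD//.
    rewrite (le_trans (cauchy_schwarz _ _))// mulrAC ler_wpM2r//.
    by rewrite mulrC yP.
  rewrite (le_trans (cauchy_schwarz _ _))// -mulrA ler_wpM2l//.
  by rewrite mulrC yP.
- move=> x; apply/eqP; rewrite -subr_eq0; apply/eqP.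
  apply: (@norm_half_exp_eq0 _ _ _ `|x|) => n.
  (* Both y and [G y] lie within 2^-(n+1) of [Y n.+1], the latter because [Y n.+1] is [G (Y n)] and
     [G] contracts. Together the errors make 2^-n. *)
  rewrite (le_trans (ler_distD (Y n.+1 x) _ _))//.
  rewrite (_ : `|x| * _ = 2^-1 ^+ n.+1 * `|x| + 2^-1 ^+ n.+1 * `|x|);
    last first.
    by rewrite exprSr -mulrDl -splitr mulrC.
  rewrite lerD// exprSr.
  rewrite -[X in `|_ - X|]/(G y x); apply: sqrt_step_contract => //.
  + exact: sqrt_iter_half.
  + by move=> z; rewrite distrC yP.
Qed.

End SquareRoot.
End StarSubalgebra.

(** * The C*-algebra generated by a set of bounded operators *)

Lemma bounded_op_Cstar : is_Cstar_algebra (@bounded_op R H).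
Proof.
split; last by move=> T.
split=> //.
- apply: (bounded_opN (c := 0)) => // [a u v|x] /=.
    by rewrite scaler0 addr0.
  by rewrite normr0 mul0r.
- move=> k T S /bounded_opP[lT [c c0 Tc]] /bounded_opP[lS [d d0 Sd]].
  apply: (bounded_opN (c := `|k| * c + d)) => [a u v||x].
  + rewrite -[LHS]/(k *: T (a *: u + v) + S (a *: u + v)).
    rewrite -[RHS]/(a *: (k *: T u + S u) + (k *: T v + S v)).
    by rewrite lT lS !scalerDr !scalerA (mulrC k) addrACA.
  + by rewrite addr_ge0 ?mulr_ge0.
  + rewrite (le_trans (ler_normD _ _))// mulrDl lerD// normrZ -mulrA.
    by rewrite ler_wpM2l.
- move=> T S /bounded_opP[lT [c c0 Tc]] /bounded_opP[lS [d d0 Sd]].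
  apply: (bounded_opN (c := c * d)) => [a u v||x] /=.
  + by rewrite lS lT.
  + exact: mulr_ge0.
  + by rewrite (le_trans (Tc _))// -mulrA ler_wpM2l.
- by move=> T /adj_bounded[].
Qed.

(** All closure properties pass to intersections. Boundedness of the elements comes from the ambient
    algebra of bounded operators, which is one of the algebras intersected. *)
Lemma smallest_Cstar (X : set (H -> H)) :
  X `<=` @bounded_op R H -> is_Cstar_algebra (smallest is_Cstar_algebra X).
Proof.
move=> XB; split; last first.
  move=> T bT TX M [CM XM]; have [_ clM] := CM; apply: clM => // e e0.
  by have [S SX TS] := TX e e0; exists S => //; apply: SX.
split.
- by apply: smallest_sub => //; exact: bounded_op_Cstar.
- by move=> M [[[]]].
- move=> k T S TX SX M MX; have [[[_ _ + _ _] _] _] := MX.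
  by apply; [exact: TX|exact: SX].
- move=> T S TX SX M MX; have [[[_ _ _ + _] _] _] := MX.
  by apply; [exact: TX|exact: SX].
- by move=> T TX M MX; have [[[_ _ _ _ +] _] _] := MX; apply; exact: TX.
Qed.

End HilbertSpaces.

(** * Norm bounds and fixed points of endomorphisms of the quasilocal algebra *)

Section Endomorphisms.
Context {R : realType} {H : hilbertSpace R} {N : conformal_net H}.
Variable rho : endomorphism N.
Local Notation "'[ x , y ]" := (inner H x y).
Local Notation A := (quasilocal N).
Implicit Types a b : A.

Lemma quasilocal_Cstar : is_Cstar_algebra A.
Proof.
rewrite quasilocalE; apply: smallest_Cstar => T [I hI].
by have [[AB _ _ _ _] _] := net_vN N hI; exact: AB.
Qed.

Let sA : star_subalgebra A. Proof. by have [] := quasilocal_Cstar. Qed.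
Let cA : norm_closed A. Proof. by have [] := quasilocal_Cstar. Qed.

Lemma quasilocal_lift T : A T -> exists a, val a = T.
Proof. by move=> /mem_set AT; exists (exist _ T AT). Qed.

Lemma quasilocal_val a : A (val a).
Proof. exact: set_mem (valP a). Qed.

Lemma quasilocal_bounded a : bounded_op (val a).
Proof. exact: (@star_bounded _ _ _ sA (val a) (quasilocal_val a)). Qed.

Lemma quasilocal_is_adjoint a : is_adjoint (val a) (adj (val a)).
Proof. exact: (@adj_adjoint _ _ (val a) (quasilocal_bounded a)). Qed.

Lemma endo_contract a :
  (forall x, `|val a x| ^+ 2 <= 2^-1 * `|x| ^+ 2) ->
  forall x, `|val (rho a) x| <= `|x|.
Proof.
move=> ax.
have aN := quasilocal_is_adjoint a.
have [b bE] : exists b, val b = adj (val a).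
  apply: quasilocal_lift; have [_ _ _ _ +] := sA.
  by apply; exact: quasilocal_val.
have [t tE] : exists t : A, val t = val b \o val a.
  by apply/quasilocal_lift/(star_mul sA); exact: quasilocal_val.
have tin u v : '[val t u, v] = '[val a u, val a v].
  by rewrite tE/= bE [LHS](is_adjoint_sym aN).
have t_adj : is_adjoint (val t) (val t).
  by move=> u v; rewrite tin innerC -tin -innerC.
(* With t = a^* a, |t x|^2 is the inner product of a x and a (t x), hence at most |a x| |a (t x)| <=
   (1/2) |x| |t x|. *)
have t_half x : `|val t x| <= 2^-1 * `|x|.
  have [->|tx0] := eqVneq (val t x) 0.
    by rewrite normr0 mulr_ge0// invr_ge0.
  have ntx : 0 < `|val t x| by rewrite normr_gt0.
  rewrite -(ler_pM2l ntx) -expr2 inner_norm tin.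
  rewrite -[leLHS]ger0_norm; last by rewrite -tin -inner_norm exprn_ge0.
  rewrite (le_trans (cauchy_schwarz _ _))//.
  rewrite -ler_sqr ?nnegrE ?mulr_ge0 ?invr_ge0// exprMn.
  rewrite (_ : (_ * (2^-1 * _)) ^+ 2 =
    (2^-1 * `|x| ^+ 2) * (2^-1 * `|val t x| ^+ 2)); last by ring.
  by rewrite ler_pM// exprn_ge0.
have [y [Ay yJ yE]] := sqrt_fixpoint sA cA (quasilocal_val t) t_half t_adj.
have [i iE] := quasilocal_lift (quasilocal_id N).
have [y' y'E] := quasilocal_lift Ay.
(* As y = 1 - sqrt (1 - t), the root is s = 1 - y, written in the form k a + b that [endo_linear]
   accepts. *)
have [s sE] : exists s : A, val s = (-1) *: val y' + val i.
  apply: quasilocal_lift; rewrite y'E iE.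
  exact: (star_add sA (star_scale sA (-1) Ay) (quasilocal_id N)).
have sxE x : val s x = x - y x.
  by rewrite sE iE y'E -[LHS]/((-1) *: y x + x) scaleN1r addrC.
have sJ : val s = adj (val s).
  apply/esym/adjE => u v; rewrite !sxE innerBl innerBr.
  by congr (_ - _); exact: yJ.
have [w wE] : exists w : A, val w = val s \o val s.
  by apply/quasilocal_lift/(star_mul sA); exact: quasilocal_val.
(* This is 1 = s^2 + t: expand s^2 = 1 - 2 y + y^2 and use 2 y = t + y^2. Applying rho carries the
   identity to the images. *)
have wtE : val i = 1 *: val w + val t.
  apply/funext => x.
  rewrite iE -[RHS]/(1 *: val w x + val t x) scale1r wE /= !sxE.
  have -> : y (x - y x) = y x - y (y x).
    by rewrite linear_sub//; exact: star_linear sA _ Ay.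
  have := yE x; move/(congr1 (fun v : H => 2 *: v)).
  rewrite scalerA divff ?pnatr_eq0// scale1r scaler_nat mulr2n => h.
  rewrite opprB addrA addrAC -(addrA x) -[- y x + _]addrC.
  have -> : val t x = (y x + y x) - y (y x) by rewrite h addrK.
  set u := y x + y x; set v := y (y x); rewrite -opprD -/u -(addrA (x - u)).
  by rewrite (addrCA v) subrr addr0 subrK.
have rt := endo_mul rho tE.
have rb := endo_star rho bE.
have rw := endo_mul rho wE.
have rs := endo_star rho sJ.
have := endo_linear rho wtE; rewrite (endo_unital rho iE) => ri x.
rewrite -ler_sqr ?nnegrE// -subr_ge0.
have -> : `|x| ^+ 2 - `|val (rho a) x| ^+ 2 = `|val (rho s) x| ^+ 2.
  rewrite !inner_norm.
  have -> : '[val (rho s) x, val (rho s) x] = '[val (rho w) x, x].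
    by rewrite rw/= {3}rs [RHS](is_adjoint_sym (quasilocal_is_adjoint _)).
  have -> : '[val (rho a) x, val (rho a) x] = '[val (rho t) x, x].
    by rewrite rt/= rb [RHS](is_adjoint_sym (quasilocal_is_adjoint _)).
  have xE : x = val (rho w) x + val (rho t) x.
    rewrite -{1}[x]/(id x) ri -[LHS]/(1 *: val (rho w) x + val (rho t) x).
    by rewrite scale1r.
  by rewrite -innerBl {1}xE addrK.
by rewrite exprn_ge0.
Qed.

(** Dividing a by 2 e gives norm at most 1/2, so its square is at most 1/4 <= 1/2 and
    [endo_contract] applies. The factor 2 is harmless, as only continuity of rho is wanted. *)
Lemma endo_bound a e : 0 < e -> (forall x, `|val a x| <= e * `|x|) ->
  forall x, `|val (rho a) x| <= 2 * e * `|x|.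
Proof.
move=> e0 ax x; have k0 : 0 < 2 * e by rewrite mulr_gt0.
have [c cE] : exists c : A, val c = (2 * e)^-1 *: val a.
  exact/quasilocal_lift/(star_scale sA _ (quasilocal_val a)).
have cx u : val c u = (2 * e)^-1 *: val a u by rewrite cE.
have nc u : `|val c u| <= 2^-1 * `|u|.
  rewrite cx normrZ gtr0_norm ?invr_gt0// ler_pdivrMl// mulrA.
  by rewrite (_ : 2 * e / 2 = e) ?ax//; field.
(* Splitting 2 e as (2 e - 1) + 1 brings a = 2 e c into the form required by [endo_linear]. *)
have aE : val a = (2 * e - 1) *: val c + val c.
  apply/funext => u; rewrite -[RHS]/((2 * e - 1) *: val c u + val c u).
  by rewrite scalerBl scale1r subrK cx scalerA divff ?gt_eqF// scale1r.
have := congr1 (fun T => T x) (endo_linear rho aE).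
rewrite -[X in _ = X -> _]/((2 * e - 1) *: val (rho c) x + val (rho c) x).
rewrite scalerBl scale1r subrK => ->.
rewrite normrZ (gtr0_norm k0) ler_pM2l//; apply: endo_contract => u.
rewrite (le_trans (_ : _ <= (2^-1 * `|u|) ^+ 2))//.
  by rewrite ler_sqr ?nnegrE ?mulr_ge0 ?invr_ge0.
rewrite exprMn ler_wpM2r ?exprn_ge0// expr2 ler_piMl ?invr_ge0//.
by rewrite invf_le1// ler1n.
Qed.

(** A set of operators rather than of elements of the subtype, so that it can be one of the algebras
    intersected in [smallest is_Cstar_algebra]. *)
Definition fixed_points : set (H -> H) :=
  [set T | exists2 a : A, val a = T & val (rho a) = T].

Lemma fixed_points_Cstar : is_Cstar_algebra fixed_points.
Proof.
split; last first.
  move=> T bT TF.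
  have AT : A T.
    apply: cA => // e e0; have [S [a aS _] TS] := TF e e0.
    by exists S => //; rewrite -aS; exact: quasilocal_val.
  have [a aT] := quasilocal_lift AT; exists a => //.
  apply/funext => x; apply/eqP; rewrite -subr_eq0; apply/eqP.
  (* Take a fixed b within 2^-n of a. Then rho a is within 2 * 2^-n of rho b = b by [endo_bound],
     and b is within 2^-n of a, whence the 3. *)
  apply: (@norm_half_exp_eq0 _ _ _ (3 * `|x|)) => n.
  have n0 : 0 < 2^-1 ^+ n :> R[i] by rewrite exprn_gt0.
  have [_ [b <- rb] TS] := TF _ n0.
  have [c cE] : exists c : A, val c = (-1) *: val b + val a.
    apply: quasilocal_lift.
    have Ab := star_scale sA (-1) (quasilocal_val b).
    exact: (star_add sA Ab (quasilocal_val a)).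
  have rhoc := endo_linear rho cE.
  have cb y : `|val c y| <= 2^-1 ^+ n * `|y|.
    rewrite cE -[X in `|X|]/((-1) *: val b y + val a y) scaleN1r addrC aT.
    exact: TS.
  have := endo_bound n0 cb x.
  rewrite rhoc -[X in `|X|]/((-1) *: val (rho b) x + val (rho a) x) scaleN1r rb.
  rewrite addrC => ab.
  rewrite (le_trans (ler_distD (val b x) _ _))//.
  rewrite (_ : 3 * `|x| * _ = 2 * 2^-1 ^+ n * `|x| + 2^-1 ^+ n * `|x|);
    last by ring.
  by rewrite lerD// distrC TS.
have FA T : fixed_points T -> A T by move=> [a <- _]; exact: quasilocal_val.
have [AB A0 AD AM AJ] := sA.
split.
- by move=> T /FA; exact: AB.
- have [z zE] := quasilocal_lift A0; exists z => //.
  (* From 0 = 1 0 + 0 follows rho 0 = rho 0 + rho 0, so rho 0 = 0. *)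
  have /(endo_linear rho)/(congr1 (fun T => T - val (rho z))) :
    val z = 1 *: val z + val z by rewrite zE scale1r addr0.
  by rewrite subrr addrK scale1r => <-.
- move=> k T S FT FS; have [a aT ra] := FT; have [b bS rb] := FS.
  have [c cE] := quasilocal_lift (AD k _ _ (FA _ FT) (FA _ FS)).
  exists c => //; rewrite -ra -rb; apply: endo_linear.
  by rewrite aT bS.
- move=> T S FT FS; have [a aT ra] := FT; have [b bS rb] := FS.
  have [c cE] := quasilocal_lift (AM _ _ (FA _ FT) (FA _ FS)).
  exists c => //; rewrite -ra -rb; apply: endo_mul.
  by rewrite aT bS.
- move=> T FT; have [a aT ra] := FT.
  have [c cE] := quasilocal_lift (AJ _ (FA _ FT)).
  by exists c => //; rewrite -ra; apply: endo_star; rewrite aT.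
Qed.

Lemma fixed_pointsE a : fixed_points (val a) -> val (rho a) = val a.
Proof. by move=> [b /val_inj ->]. Qed.

End Endomorphisms.

(** * Half-lines and their causal complements *)

Section HalfLines.
Context {R : realType}.

(** This selects the C*-algebra branch of [net_algebra]. The point of modulus |a| + |M| + 2 on the
    side of W lies in W and exceeds the supposed bound |M| + 1. *)
Lemma half_line_unbounded (W : set R) : half_lines W -> ~ bounded_set W.
Proof.
move=> [a Wa] [M [_ /(_ (`|M| + 1))]].
rewrite (le_lt_trans (ler_norm M)) ?ltrDl// => /(_ isT) WM.
case: Wa => WE.
- have /WM : W (`|a| + `|M| + 2).
    rewrite WE /= in_itv/= andbT.
    by have := ler_norm a; have := normr_ge0 M; lra.
  by rewrite /= ger0_norm ?addr_ge0//; have := normr_ge0 a; lra.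
- have /WM : W (- (`|a| + `|M| + 2)).
    rewrite WE /= in_itv/=; have := ler_norm (- a); have := normr_ge0 M.
    by rewrite normrN; lra.
  by rewrite /= normrN ger0_norm ?addr_ge0//; have := normr_ge0 a; lra.
Qed.

Lemma causal_complement_ray_gt (a : R) :
  causal_complement `]a, +oo[%classic = `]-oo, a[%classic.
Proof.
rewrite /causal_complement -setCitvr; congr (~` _).
apply/seteqP; split.
  rewrite [X in _ `<=` X](closure_id _).1; last exact: interval_closed.
  by apply: closureS => x /=; rewrite !in_itv/= !andbT => /ltW.
move=> x; rewrite /= in_itv/= andbT => ax B /nbhs_ballP[e /= e0 eB].
(* A point x >= a, possibly the endpoint, is approached from inside the open ray by moving e/2 to
   the right. *)
exists (x + e / 2); split.
  by rewrite /= in_itv/= andbT (le_lt_trans ax)// ltrDl divr_gt0.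
by apply: eB; rewrite -ball_normE /= opprD addNKr normrN gtr0_norm ?divr_gt0//;
  lra.
Qed.

Lemma causal_complement_ray_lt (a : R) :
  causal_complement `]-oo, a[%classic = `]a, +oo[%classic.
Proof.
rewrite /causal_complement -setCitvl; congr (~` _).
apply/seteqP; split.
  rewrite [X in _ `<=` X](closure_id _).1; last exact: interval_closed.
  by apply: closureS => x /=; rewrite !in_itv/= => /ltW.
move=> x; rewrite /= in_itv/= => ax B /nbhs_ballP[e /= e0 eB].
exists (x - e / 2); split.
  by rewrite /= in_itv/= (lt_le_trans _ ax)// gtrBl divr_gt0.
by apply: eB; rewrite -ball_normE /= opprB addrC subrK gtr0_norm ?divr_gt0//;
  lra.
Qed.

Lemma causal_complementK (W : set R) : half_lines W ->
  causal_complement (causal_complement W) = W.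
Proof.
move=> [a [->|->]];
  by rewrite !(causal_complement_ray_gt, causal_complement_ray_lt).
Qed.

End HalfLines.

(** * Equality of the dual and the localizable subcategory *)

Theorem proposition4p3 (R : realType) (H : hilbertSpace R)
    (N : conformal_net H) (hHaag : Haag_duality N)
    (W : set R) (hW : half_lines W) :
  dual N (net_algebra N W) = DHR_localizable N (causal_complement W).
Proof.
(* Both sides are full subcategories, so it suffices to compare the conditions on objects; W'' = W
   turns localizability in W' into a condition on intervals inside W. *)
congr full_subcategory; apply/seteqP; split=> rho /=;
  rewrite /localizable_endo /localizable causal_complementK//.
  move=> triv J hJ JW a aJ; apply: triv.
  rewrite /net_algebra asboolF; last exact: half_line_unbounded.
  by apply: sub_gen_smallest; exists J.
move=> loc a; rewrite /net_algebra asboolF; last exact: half_line_unbounded.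
move=> aW; apply: fixed_pointsE.
(* Membership of a in the generated algebra means membership in every C*-algebra containing the
   generators, in particular in the fixed points of rho. *)
apply: aW; split; first exact: fixed_points_Cstar.
move=> T [J [hJ JW] JT].
have [b bT] : exists b : quasilocal N, val b = T.
  apply: quasilocal_lift; rewrite quasilocalE.
  by apply: sub_gen_smallest; exists J.
by exists b => //; rewrite -bT; apply: (loc J) => //; rewrite bT.
Qed.
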